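(* Let $I_3=(x(y^3-z^3),\,y(z^3-x^3),\,z(x^3-y^3))\subset \mathbb{C}[x,y,z]$. Then $\alpha(I_3^{(3m+1)})=9m+4$ for all integers $m\ge 0$.
   Context: Let $R=\mathbb{C}[x,y,z]$ with the standard grading. For a nonzero homogeneous ideal $J\subseteq R$, $\alpha(J)$ denotes the least degree of a nonzero homogeneous polynomial in $J$. For a homogeneous ideal $I\subseteq R$ and an integer $m\ge 1$, the $m$-th symbolic power of $I$ is $I^{(m)}:=\bigcap_{\mathfrak{p}\in \mathrm{Ass}(R/I)} \left(I^mR_{\mathfrak{p}}\cap R\right)$. *)

(* Defs.v *)
From mathcomp Require Import all_boot all_order all_algebra ring_quotient.
From mathcomp Require Import boolp classical_sets reals.
From mathcomp Require Import complex mpoly.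

Set Implicit Arguments.
Unset Strict Implicit.
Unset Printing Implicit Defensive.

Import GRing.Theory.

Local Open Scope classical_set_scope.
Local Open Scope ring_scope.

Notation "x %:F" := (@FracField.tofrac _ x) : ring_scope.

Section Ideals.
Variable A : idomainType.
Implicit Types (G I J P : set A).

Definition ideal_gen G : set A :=
  [set f | exists k (c g : 'I_k -> A),
     (forall i, G (g i)) /\ f = \sum_(i < k) c i * g i].

Definition ideal_pow I (m : nat) : set A :=
  ideal_gen [set \prod_(i < m) a i | a in [set a : 'I_m -> A | forall i, I (a i)]].

(* [idealr_closed] includes properness: 1 is not in P. *)
Definition prime_ideal P : Prop :=
  idealr_closed (fun f => f \in P) /\ prime_idealr_closed (fun f => f \in P).

(* Ass(A/I): the primes that are the annihilator of the class of some g. *)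
Definition assoc_primes I : set (set A) :=
  [set P | prime_ideal P /\ exists g, P = [set r | I (r * g)]].

(* As A is a domain, the localization A_P is taken inside Frac(A). *)
Definition localization P : set {fraction A} :=
  [set u | exists a s, ~ P s /\ u = a%:F / s%:F].

(* The extended ideal J A_P. *)
Definition loc_ext P J : set {fraction A} :=
  [set u | exists k (c : 'I_k -> {fraction A}) (g : 'I_k -> A),
     [/\ forall i, localization P (c i),
         forall i, J (g i)
       & u = \sum_(i < k) c i * (g i)%:F]].

Definition symbolic_power I (m : nat) : set A :=
  \bigcap_(P in assoc_primes I) [set f | loc_ext P (ideal_pow I m) f%:F].

End Ideals.

Section Alpha.
Variables (K : fieldType) (n : nat).

Definition has_form_of_degree (J : set {mpoly K[n]}) (d : nat) : Prop :=
  exists f : {mpoly K[n]}, [/\ J f, f != 0 & f \is d.-homog].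

(* The default value 0 is returned only if J has no nonzero form. *)
Definition alpha (J : set {mpoly K[n]}) : nat :=
  xget 0%N [set d | has_form_of_degree J d /\
                    forall e, has_form_of_degree J e -> (d <= e)%N].

End Alpha.

Section Fermat.
Variable R : realType.

Local Notation x := ('X_0 : {mpoly R[i][3]}).
Local Notation y := ('X_1 : {mpoly R[i][3]}).
Local Notation z := ('X_2 : {mpoly R[i][3]}).

Definition I3 : set {mpoly R[i][3]} :=
  ideal_gen [set x * (y ^+ 3 - z ^+ 3);
                 y * (z ^+ 3 - x ^+ 3);
                 z * (x ^+ 3 - y ^+ 3)].

End Fermat.
Arguments I3 : clear implicits.

(* Main.v *)
From HB Require Import structures.
Require Import Defs.
From mathcomp Require Import all_boot all_order all_algebra.
From mathcomp Require Import reals complex mpoly.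
From mathcomp Require Import ring_quotient boolp classical_sets ring zify.

(* Let D = (x^3-y^3)(y^3-z^3)(z^3-x^3) be the product of the nine lines of the
   Fermat configuration; each of its twelve points lies on three of the lines,
   and each line contains four of the points.

   Lower bound: if f vanishes to order 3m+1 at the twelve points and
   deg f < 9m+4, then f restricted to a line has 4(3m+1) > deg f zeros, so every
   line divides f. Hence f = D g, where g vanishes to order 3(m-1)+1 and has
   degree deg f - 9, and one concludes by induction on m.

   Upper bound: D^m x(y^3-z^3) lies in the symbolic power, because x^9 D, y^9 D
   and z^9 D all lie in I^3 and no associated prime of I contains x, y and z
   (I is saturated). *)

Set Implicit Arguments.
Unset Strict Implicit.
Unset Printing Implicit Defensive.

Import GRing.Theory.

Local Open Scope classical_set_scope.
Local Open Scope ring_scope.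

(** * Ideals *)

Section IdealTheory.
Variable A : idomainType.
Implicit Types (G I J : set A) (f g r : A).

Definition is_ideal J := J 0 /\ forall r f g, J f -> J g -> J (r * f + g).

Lemma is_idealD J f g : is_ideal J -> J f -> J g -> J (f + g).
Proof. by move=> [_ JD] Jf Jg; rewrite -[f]mul1r; apply: JD. Qed.

Lemma is_idealM J r f : is_ideal J -> J f -> J (r * f).
Proof. by move=> [J0 JD] Jf; rewrite -[_ * _]addr0; apply: JD. Qed.

Lemma is_idealMr J r f : is_ideal J -> J f -> J (f * r).
Proof. by rewrite mulrC; apply: is_idealM. Qed.

Lemma is_idealB J f g : is_ideal J -> J f -> J g -> J (f - g).
Proof. by move=> [_ JD] Jf Jg; rewrite addrC -mulN1r; apply: JD. Qed.

Lemma is_ideal_sum J (T : Type) (s : seq T) (F : T -> A) :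
  is_ideal J -> (forall i, J (F i)) -> J (\sum_(i <- s) F i).
Proof.
move=> idJ JF; elim/big_ind: _ => // [|f g]; first by case: idJ.
exact: is_idealD.
Qed.

Lemma ideal_gen_ideal G : is_ideal (ideal_gen G).
Proof.
split=> [|r f g [k [c [a [Ga ->]]]] [l [d [b [Gb ->]]]]].
  exists 0%N, (fun=> 0), (fun=> 0); split=> [[]//|].
  by rewrite big_ord0.
exists (k + l)%N,
  (fun i => match split i with inl j => r * c j | inr j => d j end),
  (fun i => match split i with inl j => a j | inr j => b j end); split=> [i|].
  by case: split.
rewrite big_split_ord /= mulr_sumr; congr (_ + _); apply: eq_bigr => i _.
  by have /= -> := unsplitK (inl i); rewrite mulrA.
by have /= -> := unsplitK (inr i).
Qed.

Lemma mem_ideal_gen G f : G f -> ideal_gen G f.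
Proof.
move=> Gf; exists 1%N, (fun=> 1), (fun=> f); split=> //.
by rewrite big_ord1 mul1r.
Qed.

Lemma ideal_gen_min G J : is_ideal J -> G `<=` J -> ideal_gen G `<=` J.
Proof.
move=> idJ GJ _ [k [c [a [Ga ->]]]]; apply: is_ideal_sum => // i.
by apply: is_idealM => //; apply: GJ.
Qed.

Lemma ideal_pow_ideal I m : is_ideal (ideal_pow I m).
Proof. exact: ideal_gen_ideal. Qed.

Lemma ideal_pow0 I f : ideal_pow I 0 f.
Proof.
rewrite -[f]mulr1; apply: is_idealM (ideal_pow_ideal I 0) _.
apply: mem_ideal_gen.
by exists (fun=> 0) => [[]//|]; rewrite big_ord0.
Qed.

Lemma ideal_pow1 I f : I f -> ideal_pow I 1 f.
Proof.
by move=> If; apply: mem_ideal_gen; exists (fun=> f) => //; rewrite big_ord1.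
Qed.

Lemma ideal_powM I m n f g :
  ideal_pow I m f -> ideal_pow I n g -> ideal_pow I (m + n) (f * g).
Proof.
have idP := ideal_pow_ideal I (m + n).
move=> If Ig; move: f If; apply: ideal_gen_min => [|_ [a Ia <-]].
  split=> [|r f1 f2 If1 If2]; first by rewrite mul0r; case: idP.
  by rewrite mulrDl -mulrA; apply: is_idealD => //; apply: is_idealM.
move: g Ig; apply: ideal_gen_min => [|_ [b Ib <-]].
  split=> [|r f1 f2 If1 If2]; first by rewrite mulr0; case: idP.
  by rewrite mulrDr mulrCA; apply: is_idealD => //; apply: is_idealM.
apply: mem_ideal_gen.
exists (fun i => match split i with inl j => a j | inr j => b j end) => [i|].
  by case: split.
rewrite big_split_ord; congr (_ * _); apply: eq_bigr => i _.
  by have /= -> := unsplitK (inl i).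
by have /= -> := unsplitK (inr i).
Qed.

Lemma ideal_powX I m n f : ideal_pow I m f -> ideal_pow I (m * n) (f ^+ n).
Proof.
move=> If; elim: n => [|n IHn]; first by rewrite muln0; apply: ideal_pow0.
by rewrite exprS mulnS; apply: ideal_powM.
Qed.

Lemma ideal_pow3 I f g h : I f -> I g -> I h -> ideal_pow I 3 (f * g * h).
Proof.
move=> If Ig Ih; rewrite (_ : 3 = 1 + 1 + 1)%N //.
by do 2?[apply: ideal_powM]; apply: ideal_pow1.
Qed.

Definition multiple_of f g := exists h, g = f * h.

Lemma multiple_of_ideal f : is_ideal (multiple_of f).
Proof.
split=> [|r _ _ [a ->] [b ->]]; first by exists 0; rewrite mulr0.
by exists (r * a + b); ring.
Qed.

(** An explicit certificate. With X, Y, Z the cubes and D the product, the [b] and [d] terms add up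
    to X (X-Z)^2 D, the last one contributes X (2X-Z) Z D, and (X-Z)^2 + (2X-Z) Z = X^2. *)
Lemma fermat_product_cube I (x y z : A) : is_ideal I ->
    I (x * (y ^+ 3 - z ^+ 3)) -> I (y * (z ^+ 3 - x ^+ 3)) ->
    I (z * (x ^+ 3 - y ^+ 3)) ->
  ideal_pow I 3 (x ^+ 9 *
    ((x ^+ 3 - y ^+ 3) * (y ^+ 3 - z ^+ 3) * (z ^+ 3 - x ^+ 3))).
Proof.
set a := x * _; set b := y * _; set c := z * _ => idI Ia Ib Ic.
(* The y^3 terms cancel, so [d] is x z (x^3 - z^3). *)
pose d := z * a + x * c.
have Id : I d by apply: is_idealD => //; apply: is_idealM.
have idP := ideal_pow_ideal I 3.
have -> : x ^+ 9 * ((x ^+ 3 - y ^+ 3) * (y ^+ 3 - z ^+ 3) * (z ^+ 3 - x ^+ 3)) =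
  ((x ^+ 3 - y ^+ 3) * x ^+ 3) * (b * b * b) + (x ^+ 3 - y ^+ 3) * (d * d * d)
  - ((2 * x ^+ 3 - z ^+ 3) * z * x) * (a * d * c).
  by rewrite /d /a /b /c; ring.
apply: is_idealB => //; last by apply: is_idealM => //; apply: ideal_pow3.
by apply: is_idealD => //; apply: is_idealM => //; apply: ideal_pow3.
Qed.

End IdealTheory.

(** * Multiple roots of univariate polynomials over a domain *)

Section PolyDvd.
Variable A : idomainType.
Implicit Types (f g : {poly A}) (c : A).

(** One factor ['X - c%:P] is cancelled at a time, since over a domain [f.[c]] need not be a unit
    and a Bezout relation may fail to exist. *)
Lemma expXsubC_multipleMl k c f g : f.[c] != 0 ->
  multiple_of (('X - c%:P) ^+ k) (f * g) -> multiple_of (('X - c%:P) ^+ k) g.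
Proof.
move=> fc; elim: k g => [|k IHk] g; first by exists g; rewrite mul1r.
move=> [h eq_fg]; have /factor_theorem[g' eq_g] : root g c.
  have := congr1 (horner^~ c) eq_fg.
  rewrite /root hornerM exprS -mulrA hornerM hornerXsubC subrr mul0r => /eqP.
  by rewrite mulf_eq0 (negPf fc).
have [|h' eq_g'] := IHk g'.
  exists h; apply: (mulIf (monic_neq0 (monicXsubC c))).
  by rewrite -[LHS]mulrA -eq_g eq_fg exprS; ring.
by exists h'; rewrite eq_g eq_g' exprS; ring.
Qed.

Lemma prod_XsubC_multiple k (s : seq A) f : uniq s ->
  (forall c, c \in s -> multiple_of (('X - c%:P) ^+ k) f) ->
  multiple_of (\prod_(c <- s) ('X - c%:P) ^+ k) f.
Proof.
elim: s => [|c s IHs] /= => [_ _|/andP[cs us] dvf].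
  by exists f; rewrite big_nil mul1r.
have [|h eq_f] := IHs us; first by move=> d ds; apply: dvf; rewrite inE ds orbT.
have : multiple_of (('X - c%:P) ^+ k) f by apply: dvf; rewrite mem_head.
rewrite eq_f => /expXsubC_multipleMl[|h' ->].
  rewrite horner_prod prodf_seq_neq0; apply/allP => d ds.
  rewrite horner_exp hornerXsubC expf_neq0 // subr_eq0.
  by apply: contraNneq cs => ->.
by exists h'; rewrite big_cons; ring.
Qed.

(** The product is monic of degree [k * size s], so a nonzero multiple of it is too large. *)
Lemma prod_XsubC_multiple_eq0 k (s : seq A) f : uniq s ->
  (forall c, c \in s -> multiple_of (('X - c%:P) ^+ k) f) ->
  (size f <= k * size s)%N -> f = 0.
Proof.
move=> us dvf sf; have [h eq_f] := prod_XsubC_multiple us dvf.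
apply/eqP; case: (eqVneq h 0) => [h0|h0]; first by rewrite eq_f h0 mulr0.
have mon : \prod_(c <- s) ('X - c%:P) ^+ k \is monic.
  by apply: monic_prod => c _; rewrite monic_exp ?monicXsubC.
have sQ : (size (\prod_(c <- s) ('X - c%:P) ^+ k)).-1 = (k * size s)%N.
  by rewrite prodrXl size_exp size_prod_XsubC mulnC.
move: sf; rewrite eq_f size_monicM // -sQ.
move: h0 (monic_neq0 mon); rewrite -!size_poly_gt0.
set Q := \prod_(c <- s) _.
case: (size h) (size Q) => // a [] // b _ _.
by rewrite addnS /= ltnNge leq_addr.
Qed.

End PolyDvd.

Lemma ker_ideal (A B : idomainType) (phi : {rmorphism A -> B}) :
  is_ideal [set f | phi f = 0].
Proof.
split=> [|r f g /= f0 g0]; first exact: rmorph0.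
by rewrite /= rmorphD rmorphM f0 g0 mulr0 addr0.
Qed.

(** * Substitution endomorphisms and congruences between polynomials *)

Section Substitution.
Variables (n : nat) (K : idomainType).

Lemma mmapXi (S : comNzRingType) (h : {rmorphism K -> S}) (v : 'I_n -> S) i :
  mmap h v 'X_i = v i.
Proof. by rewrite mmapX mmap1U. Qed.

Lemma rmorph_mmap (S S' : comNzRingType) (h : K -> S) (h' : K -> S')
    (v : 'I_n -> S) (v' : 'I_n -> S') (phi : {rmorphism S -> S'}) f :
  (forall c, phi (h c) = h' c) -> (forall i, phi (v i) = v' i) ->
  phi (mmap h v f) = mmap h' v' f.
Proof.
move=> eh ev; rewrite /mmap rmorph_sum; apply: eq_bigr => m _.
rewrite rmorphM eh /mmap1 rmorph_prod; congr (_ * _); apply: eq_bigr => i _.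
by rewrite rmorphXn ev.
Qed.

Definition subst (v : 'I_n -> {mpoly K[n]}) : {mpoly K[n]} -> {mpoly K[n]} :=
  mmap (@mpolyC n K) v.

HB.instance Definition _ v :=
  GRing.RMorphism.copy (subst v) (mmap (@mpolyC n K) v).

Lemma substX v i : subst v 'X_i = v i.
Proof. exact: mmapXi. Qed.

(** Congruence modulo an ideal respects sums and products, so it passes from the variables to every
    polynomial in them. *)
Lemma sub_subst_ideal (J : set {mpoly K[n]}) v :
  is_ideal J -> (forall i, J ('X_i - v i)) -> forall f, J (f - subst v f).
Proof.
move=> idJ Jv f.
pose R (a b : {mpoly K[n]}) := J (a - b).
have Rxx a : R a a by rewrite /R subrr; case: idJ.
have RM a b a' b' : R a b -> R a' b' -> R (a * a') (b * b').
  rewrite /R => Rab Rab'.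
  have -> : a * a' - b * b' = a' * (a - b) + b * (a' - b') by ring.
  by apply: is_idealD => //; apply: is_idealM.
rewrite -/(R _ _) {1}[f]mpolyE /subst /mmap.
elim/big_ind2: _ => [|a b a' b' Rab Rab'|m _]; first exact: Rxx.
  by rewrite /R opprD addrACA; apply: is_idealD.
rewrite -mul_mpolyC; apply: (RM) => //; rewrite -mmap1_id /mmap1.
elim/big_ind2: _ => [|a b a' b'|i _]; [exact: Rxx|exact: RM|].
elim: (m i) => [|k IHk]; first exact: Rxx.
by rewrite !exprS; apply: (RM) => //; apply: Jv.
Qed.

Lemma subst_eq0_multiple v d f : (forall i, multiple_of d ('X_i - v i)) ->
  subst v f = 0 -> multiple_of d f.
Proof.
move=> dv f0; have := sub_subst_ideal (multiple_of_ideal d) dv f.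
by rewrite f0 subr0.
Qed.

End Substitution.

Lemma ord3_ind (P : 'I_3 -> Prop) : P 0 -> P 1 -> P 2 -> forall i, P i.
Proof.
by move=> P0 P1 P2 [[|[|[|//]]] lti];
  [move: P0|move: P1|move: P2]; congr P; apply: val_inj.
Qed.

(** * The ideal of the Fermat configuration *)

Section FermatIdeal.
Variable K : idomainType.

Local Notation x := ('X_0 : {mpoly K[3]}).
Local Notation y := ('X_1 : {mpoly K[3]}).
Local Notation z := ('X_2 : {mpoly K[3]}).

(** Over the complex numbers this is [I3] by conversion, so the argument can run over general
    coefficients. *)
Definition fermat_ideal : set {mpoly K[3]} :=
  ideal_gen [set x * (y ^+ 3 - z ^+ 3);
                 y * (z ^+ 3 - x ^+ 3);
                 z * (x ^+ 3 - y ^+ 3)].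

Local Notation I := fermat_ideal.

Lemma fermat_ideal_ideal : is_ideal I.
Proof. exact: ideal_gen_ideal. Qed.
Local Notation idI := fermat_ideal_ideal.

Lemma fermat_ideal_min (J : set {mpoly K[3]}) : is_ideal J ->
  J (x * (y ^+ 3 - z ^+ 3)) -> J (y * (z ^+ 3 - x ^+ 3)) ->
  J (z * (x ^+ 3 - y ^+ 3)) -> I `<=` J.
Proof.
move=> idJ Jx Jy Jz; apply: ideal_gen_min => // _ [[->|->]|->] //.
Qed.

Lemma fermat_gen0 : I (x * (y ^+ 3 - z ^+ 3)).
Proof. by apply: mem_ideal_gen; left; left. Qed.

Lemma fermat_gen1 : I (y * (z ^+ 3 - x ^+ 3)).
Proof. by apply: mem_ideal_gen; left; right. Qed.

Lemma fermat_gen2 : I (z * (x ^+ 3 - y ^+ 3)).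
Proof. by apply: mem_ideal_gen; right. Qed.

(** Differences of cubes are spanned by x^3 - y^3 and y^3 - z^3; times two distinct variables, each
    of these is a multiple of one generator or a combination of two. *)
Lemma fermat_mulXX i k m n : i != k ->
  I ('X_i * 'X_k * ('X_m ^+ 3 - 'X_n ^+ 3)).
Proof.
have idI := idI; have g0 := fermat_gen0; have g1 := fermat_gen1.
have g2 := fermat_gen2.
have xy01 : I (x * y * (x ^+ 3 - y ^+ 3)).
  have -> : x * y * (x ^+ 3 - y ^+ 3) =
    (- y) * (x * (y ^+ 3 - z ^+ 3)) + (- x) * (y * (z ^+ 3 - x ^+ 3)) by ring.
  by apply: is_idealD => //; apply: is_idealM.
have yz12 : I (y * z * (y ^+ 3 - z ^+ 3)).
  have -> : y * z * (y ^+ 3 - z ^+ 3) =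
    (- z) * (y * (z ^+ 3 - x ^+ 3)) + (- y) * (z * (x ^+ 3 - y ^+ 3)) by ring.
  by apply: is_idealD => //; apply: is_idealM.
have dec (p : {mpoly K[3]}) :
    I (p * (x ^+ 3 - y ^+ 3)) -> I (p * (y ^+ 3 - z ^+ 3)) ->
    forall m n, I (p * ('X_m ^+ 3 - 'X_n ^+ 3)).
  move=> p01 p12 {}m {}n.
  have px m' : I (p * ('X_m' ^+ 3 - y ^+ 3)).
    elim/ord3_ind: m' => //; first by rewrite subrr mulr0; case: idI.
    by rewrite -opprB mulrN -mulN1r; apply: is_idealM.
  have -> : p * ('X_m ^+ 3 - 'X_n ^+ 3) =
    p * ('X_m ^+ 3 - y ^+ 3) - p * ('X_n ^+ 3 - y ^+ 3) by ring.
  exact: is_idealB.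
have xy : forall m n, I (x * y * ('X_m ^+ 3 - 'X_n ^+ 3)).
  apply: dec => //; rewrite mulrAC; exact: is_idealMr.
have yz : forall m n, I (y * z * ('X_m ^+ 3 - 'X_n ^+ 3)).
  by apply: dec => //; rewrite -mulrA; apply: is_idealM.
have xz : forall m n, I (x * z * ('X_m ^+ 3 - 'X_n ^+ 3)).
  apply: dec; first by rewrite -mulrA; apply: is_idealM.
  by rewrite mulrAC; exact: is_idealMr.
elim/ord3_ind: i; elim/ord3_ind: k => //= _; rewrite // (mulrC 'X__ 'X__) //.
Qed.

End FermatIdeal.

(** * Saturation of the ideal with respect to (x, y, z) *)

Section Saturation.
Variable K : idomainType.

Local Notation x := ('X_0 : {mpoly K[3]}).
Local Notation y := ('X_1 : {mpoly K[3]}).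
Local Notation z := ('X_2 : {mpoly K[3]}).
Local Notation I := (@fermat_ideal K).
Local Notation idI := (@fermat_ideal_ideal K).

Lemma mpolyX_neq0 n i : 'X_i != 0 :> {mpoly K[n]}.
Proof. by rewrite -msize_poly_eq0 msizeX. Qed.

Lemma ord3_neq : (((0 : 'I_3) == 1) = false) * (((0 : 'I_3) == 2) = false) *
  (((1 : 'I_3) == 0) = false) * (((1 : 'I_3) == 2) = false) *
  (((2 : 'I_3) == 0) = false) * (((2 : 'I_3) == 1) = false).
Proof. by []. Qed.
Definition ord3E := (ord3_neq, eqxx).

(** [subst (axis i)] is reduction modulo the two other variables, [subst (plane i)] reduction modulo
    ['X_i]. *)
Definition axis i : 'I_3 -> {mpoly K[3]} := fun k => if k == i then 'X_k else 0.
Definition plane i : 'I_3 -> {mpoly K[3]} := fun k => if k == i then 0 else 'X_k.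

Lemma plane_dec i f : exists g, f = subst (plane i) f + 'X_i * g.
Proof.
have [|k|g eq_f] := @sub_subst_ideal _ _ (multiple_of 'X_i) (plane i) _ _ f.
- exact: multiple_of_ideal.
- rewrite /plane; case: eqP => [->|_].
    by exists 1; rewrite subr0 mulr1.
  by exists 0; rewrite subrr mulr0.
by exists g; rewrite -eq_f addrC subrK.
Qed.

Lemma plane_eq0 i f : subst (plane i) f = 0 -> multiple_of 'X_i f.
Proof.
by move=> f0; have [g eq_f] := plane_dec i f; exists g; rewrite [LHS]eq_f f0 add0r.
Qed.

Lemma axis_eq0 i j k f : [&& i != j, j != k & k != i] ->
  subst (axis i) f = 0 -> exists a b, f = 'X_j * a + 'X_k * b.
Proof.
move=> ijk f0.
pose J := [set f | exists a b : {mpoly K[3]}, f = 'X_j * a + 'X_k * b].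
have idJ : is_ideal J.
  split=> [|r _ _ [a [b ->]] [c [d ->]]]; first by exists 0, 0; ring.
  by exists (r * a + c), (r * b + d); ring.
have := sub_subst_ideal (v := axis i) idJ _ f; rewrite f0 subr0; apply=> m.
rewrite /axis; case: eqP => [_|/eqP mi].
  by exists 0, 0; rewrite subrr; ring.
have [<-|mj] := eqVneq j m; first by exists 1, 0; ring.
have -> : m = k.
  move: ijk mi mj {f0 J idJ}.
  by elim/ord3_ind: i; elim/ord3_ind: j; elim/ord3_ind: k; elim/ord3_ind: m.
by exists 0, 1; ring.
Qed.

(** At z = 0 the relation forces x^3 f = 0, so z divides f and one z can be cancelled; the general
    exponent serves this induction. *)
Lemma coprime_powers n f g : x ^+ 3 * f + z ^+ n * g = 0 -> multiple_of (z ^+ n) f.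
Proof.
elim: n f => [|n IHn] f eq0; first by exists f; rewrite mul1r.
have [|f' eq_f] := @plane_eq0 2 f.
  have /eqP := congr1 (subst (plane 2)) eq0.
  rewrite rmorph0 !(rmorphXn, rmorphD, rmorphM) /= !substX /plane !ord3E.
  rewrite expr0n mul0r addr0.
  by rewrite mulf_eq0 expf_eq0 /= (negPf (mpolyX_neq0 _)) => /eqP.
have [|h eq_f'] := IHn f'.
  apply: (mulfI (mpolyX_neq0 2)).
  by rewrite mulr0 -eq0 eq_f (exprS _ n); ring.
by exists h; rewrite eq_f eq_f' (exprS _ n); ring.
Qed.

(* At y = 0 a relation y g = a (x^3-y^3) + b (z^3-y^3) becomes a x^3 + b z^3 = 0,
   and subtracting the corresponding Koszul relation makes a and b divisible
   by y. *)
Lemma cubes_ideal_divX g (J := [set f : {mpoly K[3]} | exists a b,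
    f = a * (x ^+ 3 - y ^+ 3) + b * (z ^+ 3 - y ^+ 3)]) :
  J (y * g) -> J g.
Proof.
move=> [a [b eq_yg]].
have [a' eq_a] := plane_dec 1 a; have [b' eq_b] := plane_dec 1 b.
set a0 := subst _ a in eq_a; set b0 := subst _ b in eq_b.
have eq0 : x ^+ 3 * a0 + z ^+ 3 * b0 = 0.
  have := congr1 (subst (plane 1)) eq_yg.
  rewrite !(rmorphXn, rmorphB, rmorphD, rmorphM) /= !substX /plane !ord3E.
  by rewrite expr0n /= mul0r !subr0 !(mulrC _ (_ ^+ 3)) => <-.
have [c eq_a0] := coprime_powers eq0.
have eq_b0 : b0 = - (x ^+ 3 * c).
  apply: (mulfI (expf_neq0 3 (mpolyX_neq0 2))).
  by apply/eqP; rewrite mulrN -addr_eq0 -eq0 eq_a0; apply/eqP; ring.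
exists (c * y ^+ 2 + a'), (b' - c * y ^+ 2); apply: (mulfI (mpolyX_neq0 1)).
by rewrite eq_yg eq_a eq_b eq_a0 eq_b0; ring.
Qed.

(** Every monomial of a generator involves two distinct variables. *)
Lemma fermat_axis i f : I f -> subst (axis i) f = 0.
Proof.
have idJ := @ker_ideal _ _ (subst (@axis i)).
apply: (fermat_ideal_min idJ).
all: rewrite /= !(rmorphXn, rmorphB, rmorphM) /= !substX /axis.
all: by case: eqP => [<-|_]; rewrite ?ord3E; ring.
Qed.

(* I is the intersection of the ideal (x^3-y^3, z^3-y^3) of nine of the points
   with the ideal (xy, yz, zx) of the coordinate points: writing
   g = a (x^3-y^3) + b (z^3-y^3), vanishing on the axes constrains a and b. *)
Lemma fermat_saturated g : (forall i, I ('X_i * g)) -> I g.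
Proof.
move=> Ig.
(* From y g in I: the three generators lie in (x^3 - y^3, z^3 - y^3), modulo which y can be
   cancelled. *)
have [a [b eq_g]] : exists a b, g = a * (x ^+ 3 - y ^+ 3) + b * (z ^+ 3 - y ^+ 3).
  apply: cubes_ideal_divX; move: (Ig 1); apply: fermat_ideal_min.
  - split=> [|r _ _ [a [b ->]] [c [d ->]]]; first by exists 0, 0; ring.
    by exists (r * a + c), (r * b + d); ring.
  - by exists 0, (- x); ring.
  - by exists (- y), y; ring.
  by exists z, 0; ring.
have ax i : subst (axis i) g = 0.
  have /eqP := fermat_axis i (Ig i); rewrite rmorphM /= substX /axis eqxx.
  by rewrite mulf_eq0 (negPf (mpolyX_neq0 _)) => /eqP.
have X3 i : 'X_i ^+ 3 != 0 :> {mpoly K[3]} by rewrite expf_neq0 ?mpolyX_neq0.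
(* On the x-axis g becomes a x^3, so a lies in (y, z); likewise the z-axis puts b in (x, y). *)
have [|a1 [a2 eq_a]] := @axis_eq0 0 1 2 a isT.
  have /eqP := ax 0; rewrite eq_g !(rmorphXn, rmorphB, rmorphD, rmorphM) /=.
  rewrite !substX /axis !ord3E.
  by rewrite expr0n /= !subr0 mulr0 addr0 mulf_eq0 (negPf (X3 _)) orbF => /eqP.
have [|b1 [b2 eq_b]] := @axis_eq0 2 0 1 b isT.
  have /eqP := ax 2; rewrite eq_g !(rmorphXn, rmorphB, rmorphD, rmorphM) /=.
  rewrite !substX /axis !ord3E.
  by rewrite expr0n /= !subr0 mulr0 add0r mulf_eq0 (negPf (X3 _)) orbF => /eqP.
(* With these forms g restricts to -(a1 + b2) y^4 on the y-axis. *)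
have [|e [f eq_ef]] := @axis_eq0 1 0 2 (a1 + b2) isT.
  have /eqP := ax 1; rewrite eq_g eq_a eq_b.
  rewrite !(rmorphXn, rmorphB, rmorphD, rmorphM) /= !substX /axis !ord3E.
  rewrite expr0n mulr0n /= !mul0r addr0 !add0r -mulrDl -mulrDr !mulf_eq0.
  by rewrite oppr_eq0 (negPf (X3 _)) (negPf (mpolyX_neq0 _)) orbF => /eqP.
have -> : g = a2 * (z * (x ^+ 3 - y ^+ 3)) + b1 * (x * (z ^+ 3 - y ^+ 3))
  + a1 * (y * (x ^+ 3 - z ^+ 3)) + e * (x * y * (z ^+ 3 - y ^+ 3))
  + f * (y * z * (z ^+ 3 - y ^+ 3)).
  rewrite eq_g eq_a eq_b (_ : b2 = x * e + z * f - a1); first by ring.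
  by rewrite -eq_ef; ring.
have idI := idI.
apply: is_idealD => //; last exact: is_idealM (fermat_mulXX _ _ _ _).
apply: is_idealD => //; last exact: is_idealM (fermat_mulXX _ _ _ _).
apply: is_idealD => //; last first.
  by rewrite -(opprB (z ^+ 3)) !mulrN -mulNr; exact: is_idealM (@fermat_gen1 K).
apply: is_idealD => //; first exact: is_idealM (@fermat_gen2 K).
by rewrite -opprB !mulrN -mulNr; exact: is_idealM (@fermat_gen0 K).
Qed.

End Saturation.

(** * The points of the configuration as associated primes *)

Section Points.
Variable K : fieldType.
Hypothesis K3 : 3 != 0 :> K.

Local Notation I := (@fermat_ideal K).
Local Notation idI := (@fermat_ideal_ideal K).

(* The twelve points, together with a coordinate l normalized to 1. *)
Definition fermat_point (l : 'I_3) (p : 'I_3 -> K) :=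
  p l = 1 /\ ((forall i, p i ^+ 3 = 1) \/ (forall i, i != l -> p i = 0)).

(* 'X_l serves as parameter of the line through the origin over the point p. *)
Definition point_var (l : 'I_3) (p : 'I_3 -> K) i : {mpoly K[3]} := p i *: 'X_l.

(** The homogeneous prime of the point p, as the kernel of restriction to the line over it. *)
Definition point_prime l p : set {mpoly K[3]} :=
  [set r | subst (point_var l p) r = 0].

Lemma ord3_cases (l i : 'I_3) : [\/ i = l, i = l + 1 | i = l + 2].
Proof.
by elim/ord3_ind: l; elim/ord3_ind: i;
  (apply: Or31; apply: val_inj; done) || (apply: Or32; apply: val_inj; done)
  || (apply: Or33; apply: val_inj; done).
Qed.

Lemma fermat_point_vanish l p f : fermat_point l p -> I f -> point_prime l p f.
Proof.
move=> [pl fp]; have idJ := @ker_ideal _ _ (subst (@point_var l p)).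
apply: (fermat_ideal_min idJ).
all: rewrite /= !(rmorphXn, rmorphB, rmorphM) /= !substX /point_var !exprZn.
all: case: fp => fp; first by rewrite !fp subrr mulr0.
all: have pE i : p i = if i == l then 1 else 0 by case: eqP => [->|/eqP/fp].
all: rewrite !pE; elim/ord3_ind: l {pl fp idJ pE}; rewrite !ord3E ?expr0n ?mulr0n.
all: by rewrite !(scale0r, subrr, mulr0, mul0r).
Qed.

Lemma prime_point_prime l p : prime_ideal (point_prime l p).
Proof.
have inP r : (r \in (fun f => f \in point_prime l p)) =
    (subst (point_var l p) r == 0).
  by apply/idP/eqP => [/set_mem|/mem_set].
split; first split.
- by rewrite inP rmorph0.
- by rewrite inP rmorph1 oner_neq0.
- move=> a u v; rewrite !inP => /eqP u0 /eqP v0.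
  by rewrite rmorphD rmorphM /= u0 v0 mulr0 addr0.
by move=> u v; rewrite !inP rmorphM mulf_eq0.
Qed.

(** Here [g] separates p from the other points. Modulo I, r g is congruent to the restriction of r
    times g, which gives one inclusion; the other holds because the prime contains I but not g. *)
Lemma assoc_point_prime l p g : fermat_point l p -> ~ point_prime l p g ->
  (forall i, I (('X_i - point_var l p i) * g)) ->
  assoc_primes I (point_prime l p).
Proof.
move=> fp g0 Ig; split; first exact: prime_point_prime.
exists g; apply/seteqP; split=> r /=.
  move=> r0; pose J := [set f | I (f * g)].
  have idJ : is_ideal J.
    split=> [|a b c Jb Jc]; first by rewrite /J /= mul0r; case: idI.
    rewrite /J /= mulrDl -mulrA; apply: is_idealD => //; first exact: idI.
    by apply: is_idealM idI _.
  have := sub_subst_ideal idJ Ig r; rewrite (r0 : subst _ r = 0) subr0.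
  exact.
move=> /(fermat_point_vanish fp)/eqP; rewrite /= rmorphM mulf_eq0.
by move=> /orP[]/eqP.
Qed.

(** The separators are X_l (X_l^3 - X_(l+1)^3) at a coordinate point and, at the other points, xyz
    times the cofactors of X_i - p_i X_l in X_i^3 - X_l^3 for both i different from l. *)
Lemma point_prime_assoc l p : fermat_point l p ->
  assoc_primes I (point_prime l p).
Proof.
move=> fp; have [pl [p1|p0]] := fp; last first.
  apply: (assoc_point_prime
    (g := 'X_l * ('X_l ^+ 3 - 'X_(l + 1) ^+ 3))) => //.
    rewrite /point_prime /= !(rmorphXn, rmorphB, rmorphM) /= !substX.
    rewrite /point_var pl scale1r (p0 (l + 1)); last by elim/ord3_ind: l {pl p0 fp}.
    rewrite scale0r expr0n mulr0n subr0 -exprS; apply/eqP.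
    by rewrite expf_neq0 ?mpolyX_neq0.
  move=> i; rewrite /point_var; have [->|il] := eqVneq i l.
    by rewrite pl scale1r subrr mul0r; case: idI.
  by rewrite p0 // scale0r subr0 mulrA; apply: fermat_mulXX.
pose q i : {mpoly K[3]} :=
  'X_i ^+ 2 + 'X_i * (p i *: 'X_l) + (p i *: 'X_l) ^+ 2.
apply: (assoc_point_prime
  (g := 'X_0 * 'X_1 * 'X_2 * (q (l + 1) * q (l + 2)))) => //.
  rewrite /point_prime /q -!mul_mpolyC /=.
  rewrite !(rmorphXn, rmorphD, rmorphM) /= !substX.
  have pC i : subst (point_var l p) (p i)%:MP = (p i)%:MP by rewrite /subst mmapC.
  rewrite !pC /point_var -!mul_mpolyC.
  rewrite pl mpolyC1 mul1r; apply/eqP.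
  have q0 i : (p i)%:MP != 0 :> {mpoly K[3]}.
    rewrite mpolyC_eq0.
    by apply: contraTneq (oner_neq0 K) => pi; rewrite -(p1 i) pi expr0n eqxx.
  (* On the line over p each cofactor [q i] becomes three times a square; this is where 3 must be
     nonzero. *)
  have q3 (t : {mpoly K[3]}) : t != 0 -> t ^+ 2 + t * t + t ^+ 2 != 0.
    move=> t0; have -> : t ^+ 2 + t * t + t ^+ 2 = 3%:MP * t ^+ 2.
      by rewrite rmorph_nat; ring.
    by rewrite mulf_neq0 ?expf_neq0 // mpolyC_eq0.
  by do ?[apply: mulf_neq0]; rewrite ?q3 ?mulf_neq0 ?q0 ?mpolyX_neq0.
move=> i; have gq (r s : {mpoly K[3]}) :
    ('X_i - point_var l p i) * r = 'X_i ^+ 3 - 'X_l ^+ 3 ->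
    I (('X_i - point_var l p i) * ('X_0 * 'X_1 * 'X_2 * (r * s))).
  move=> er.
  have -> : ('X_i - point_var l p i) * ('X_0 * 'X_1 * 'X_2 * (r * s)) =
    'X_2 * s * ('X_0 * 'X_1 * (('X_i - point_var l p i) * r)) by ring.
  by rewrite er; apply: is_idealM (@fermat_mulXX K _ _ _ _ _) => //; apply: idI.
have qE : ('X_i - point_var l p i) * q i = 'X_i ^+ 3 - 'X_l ^+ 3.
  have -> : 'X_l ^+ 3 = (p i *: 'X_l) ^+ 3 :> {mpoly K[3]}.
    by rewrite exprZn p1 scale1r.
  by rewrite /point_var /q; ring.
have [eil|ei|ei] := ord3_cases l i.
- by rewrite eil /point_var pl scale1r subrr mul0r; case: idI.
- by rewrite -ei; apply: gq.
- by rewrite -ei (mulrC (q (l + 1))); apply: gq.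
Qed.

End Points.

(** * Vanishing orders at the twelve points *)

Section Multiplicity.
Variable K : fieldType.
Hypothesis K3 : 3 != 0 :> K.

Local Notation I := (@fermat_ideal K).
Local Notation A := {mpoly K[4]}.
Local Notation lam := ('X_ord_max : A).
Local Notation dir i := ('X_(lift ord_max i) : A).

Lemma multiple_XP (B : idomainType) (f : {poly B}) : multiple_of 'X f <-> f.[0] = 0.
Proof.
split=> [[h ->]|/eqP/factor_theorem[h ->]]; first by rewrite hornerM hornerX mul0r.
by exists h; rewrite subr0 mulrC.
Qed.

Lemma expX_multipleMl (B : idomainType) k (f g : {poly B}) : f.[0] != 0 ->
  multiple_of ('X ^+ k) (f * g) -> multiple_of ('X ^+ k) g.
Proof. by move=> /expXsubC_multipleMl; rewrite subr0; apply. Qed.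

(** * Exact vanishing orders at the origin *)

Section Order.
Variable B : idomainType.
Implicit Types (f g u : {poly B}) (a b s t : B).

Definition order_eq e (f : {poly B}) := exists2 u, u.[0] != 0 & f = 'X ^+ e * u.

Lemma order_eqM e e' f f' :
  order_eq e f -> order_eq e' f' -> order_eq (e + e') (f * f').
Proof.
move=> [u u0 ->] [v v0 ->]; exists (u * v); first by rewrite hornerM mulf_neq0.
by rewrite exprD; ring.
Qed.

Lemma order_eqN e f : order_eq e (- f) -> order_eq e f.
Proof.
move=> [u u0 eq_f]; exists (- u); first by rewrite hornerN oppr_eq0.
by rewrite mulrN -eq_f opprK.
Qed.

(** Orders add under products over a domain; the induction on m uses this once D has been split
    off. *)
Lemma order_eq_multiple e k f g : order_eq e f ->
  multiple_of ('X ^+ (k + e)) (f * g) -> multiple_of ('X ^+ k) g.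
Proof.
move=> [u u0 ->] [h eq_h]; apply: (expX_multipleMl u0); exists h.
have Xe : 'X ^+ e != 0 :> {poly B} by rewrite expf_neq0 ?polyX_eq0.
by apply: (mulfI Xe); rewrite [LHS]mulrA eq_h exprD; ring.
Qed.

(** A difference of cubes defines three lines. This and the next two lemmas treat a point lying on
    none, one or all three of them. *)
Lemma cube_sub_order0 a b s t : a ^+ 3 != b ^+ 3 ->
  order_eq 0 ((a%:P + 'X * s%:P) ^+ 3 - (b%:P + 'X * t%:P) ^+ 3).
Proof.
move=> ab; exists ((a%:P + 'X * s%:P) ^+ 3 - (b%:P + 'X * t%:P) ^+ 3).
  rewrite hornerD hornerN !horner_exp !hornerD !hornerM hornerX !hornerC.
  by rewrite !mul0r !addr0 subr_eq0.
by rewrite mul1r.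
Qed.

Lemma cube_sub_order1 a b s t : a ^+ 3 = b ^+ 3 ->
    3 * (a ^+ 2 * s - b ^+ 2 * t) != 0 ->
  order_eq 1 ((a%:P + 'X * s%:P) ^+ 3 - (b%:P + 'X * t%:P) ^+ 3).
Proof.
set c := 3 * _ => ab c0.
exists (c%:P + 'X * (3 * (a * s ^+ 2 - b * t ^+ 2)%:P + 'X * (s ^+ 3 - t ^+ 3)%:P)).
  by rewrite hornerD hornerM hornerX hornerC mul0r addr0.
apply/eqP; rewrite -subr_eq0; apply/eqP; transitivity (a%:P ^+ 3 - b%:P ^+ 3).
  by rewrite /c !(rmorphXn, rmorphB, rmorphM) rmorph_nat /=; ring.
by rewrite -!rmorphXn ab subrr.
Qed.

Lemma cube_sub_order3 s t : s ^+ 3 != t ^+ 3 ->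
  order_eq 3 ((0%:P + 'X * s%:P) ^+ 3 - (0%:P + 'X * t%:P) ^+ 3).
Proof.
move=> st; exists (s ^+ 3 - t ^+ 3)%:P; first by rewrite hornerC subr_eq0.
by rewrite !add0r rmorphB !rmorphXn /=; ring.
Qed.

End Order.

(* The Taylor expansion, in powers of 'X, at the generic point lam * p of the line
   over p in the generic direction ('X_0, 'X_1, 'X_2): divisibility by 'X ^+ k is
   vanishing to order k along that line. A generic direction is needed so that
   a line through p does not vanish identically. *)
Definition germ_var (p : 'I_3 -> K) i : {poly A} :=
  (p i *: lam)%:P + 'X * (dir i)%:P.

Definition germ p : {mpoly K[3]} -> {poly A} :=
  mmap (polyC \o @mpolyC 4 K) (germ_var p).

HB.instance Definition _ p :=
  GRing.RMorphism.copy (germ p) (mmap (polyC \o @mpolyC 4 K) (germ_var p)).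

Lemma germX p i : germ p 'X_i = germ_var p i.
Proof. exact: mmapXi. Qed.

Lemma germ_at0 p f : (germ p f).[0] = mmap (@mpolyC 4 K) (fun i => p i *: lam) f.
Proof.
rewrite -horner_evalE; apply: rmorph_mmap => [c|i] /=.
  by rewrite horner_evalE hornerC.
by rewrite horner_evalE /germ_var hornerD hornerM hornerX !hornerC mul0r addr0.
Qed.

(** At ['X] = 0 the germ is the restriction to the line with parameter [lam]; sending all variables
    to ['X_l], or all to [lam], passes between the two. *)
Lemma germ_at0_eq0 l p f : (germ p f).[0] = 0 <-> point_prime l p f.
Proof.
rewrite germ_at0 /point_prime /=.
split=> [f0|/(congr1 (mmap (@mpolyC 4 K) (fun=> lam)))].
  have := congr1 (mmap (@mpolyC 3 K) (fun=> 'X_l)) f0; rewrite rmorph0 => <-.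
  apply/esym/rmorph_mmap => [c|i] /=.
    by rewrite mmapC.
  by rewrite mmapZ mmapXi mul_mpolyC.
rewrite rmorph0 => <-; apply/esym/rmorph_mmap => [c|i] /=.
  by rewrite mmapC.
by rewrite /point_var mmapZ mmapXi mul_mpolyC.
Qed.

Definition vanishing_ideal p k : set {mpoly K[3]} :=
  [set f | multiple_of ('X ^+ k) (germ p f)].

Lemma vanishing_ideal_ideal p k : is_ideal (vanishing_ideal p k).
Proof.
have [M0 MD] := multiple_of_ideal ('X ^+ k : {poly A}).
split=> [|r a b Ja Jb]; first by rewrite /vanishing_ideal /= rmorph0.
by rewrite /vanishing_ideal /= rmorphD rmorphM /=; exact: (MD _ _ _ Ja Jb).
Qed.

Lemma ideal_pow_germ l p k : fermat_point l p ->
  ideal_pow I k `<=` vanishing_ideal p k.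
Proof.
move=> fp; apply: (ideal_gen_min (vanishing_ideal_ideal p k)) => _ [a Ia <-].
rewrite /vanishing_ideal /= rmorph_prod /=.
have -> : 'X ^+ k = \prod_(i < k) 'X :> {poly A} by rewrite prodr_const card_ord.
elim/big_ind2: _ => [|d d' e e' [h ->] [h' ->]|i _]; first by exists 1; rewrite mulr1.
  by exists (h * h'); ring.
by apply/multiple_XP/(germ_at0_eq0 l)/fermat_point_vanish.
Qed.

(** Localizing at the prime of p and clearing denominators puts s f in the vanishing ideal for some
    s outside the prime. The germ of s has nonzero constant term and can be cancelled. *)
Lemma symbolic_power_germ l p k : fermat_point l p ->
  symbolic_power I k `<=` vanishing_ideal p k.
Proof.
move=> fp f /(_ _ (point_prime_assoc K3 fp))/=.
have idV := vanishing_ideal_ideal p k.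
have PM s t : ~ point_prime l p s -> ~ point_prime l p t -> ~ point_prime l p (s * t).
  rewrite /point_prime /= rmorphM => s0 t0 /eqP.
  by rewrite mulf_eq0 => /orP[]/eqP.
have P1 : ~ point_prime l p 1.
  by rewrite /point_prime /= rmorph1; apply/eqP/oner_neq0.
move=> [n [c [g [Pc Ig eq_f]]]].
suff [s [f' [Ps Vf' eq_f']]] : exists s f',
    [/\ ~ point_prime l p s, vanishing_ideal p k f' & f%:F * s%:F = f'%:F].
  have fs : f * s = f' by apply/eqP; rewrite -tofrac_eq tofracM eq_f'.
  move: Vf'; rewrite /vanishing_ideal /= -fs mulrC rmorphM /=.
  by apply: expX_multipleMl; apply/eqP => /(germ_at0_eq0 l).
rewrite {}eq_f; elim/big_ind: _ => [|u v|i _].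
- by exists 1, 0; split; rewrite ?tofrac0 ?mul0r //; case: idV.
- move=> [s [f1 [Ps Vf1 eq1]]] [t [f2 [Pt Vf2 eq2]]].
  exists (s * t), (t * f1 + s * f2); split; first exact: PM.
    exact: (is_idealD idV (is_idealM t idV Vf1) (is_idealM s idV Vf2)).
  by rewrite tofracD !tofracM -eq1 -eq2; ring.
have [a [s [Ps ->]]] := Pc i.
exists s, (a * g i); split=> //.
  exact: (is_idealM a idV (ideal_pow_germ fp (Ig i))).
rewrite tofracM mulrAC divfK // tofrac_eq0.
by apply/eqP => s0; apply: Ps; rewrite s0 /point_prime /= rmorph0.
Qed.

Definition fermat_product : {mpoly K[3]} :=
  ('X_0 ^+ 3 - 'X_1 ^+ 3) * ('X_1 ^+ 3 - 'X_2 ^+ 3) * ('X_2 ^+ 3 - 'X_0 ^+ 3).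

(** At a point with all cubes 1 each factor has order 1; at a coordinate point the factor without
    ['X_l] has order 3 and the other two have order 0. *)
Lemma germ_fermat_product l p :
  fermat_point l p -> order_eq 3 (germ p fermat_product).
Proof.
move=> [pl fp]; rewrite /fermat_product !(rmorphXn, rmorphB, rmorphM) /= !germX.
have XX_neq i j (a b : K) : i != j -> a != 0 -> a *: 'X_i - b *: 'X_j != 0 :> A.
  move=> ij a0; apply: contraNneq a0 => /(congr1 (mcoeff U_(i)%MM)).
  rewrite mcoeffB !mcoeffZ !mcoeffX eqxx eq_mnm1 [j == i]eq_sym (negPf ij) mcoeff0.
  by rewrite mulr1 mulr0 subr0 => ->.
have dneq i j : i != j -> lift ord_max i != lift ord_max j :> 'I_4.
  by apply: contraNneq => /lift_inj ->.
have lamE : lam != 0 by exact: mpolyX_neq0.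
case: fp => fp.
  have ord1 i j : i != j -> order_eq 1 (germ_var p i ^+ 3 - germ_var p j ^+ 3).
    move=> ij; apply: cube_sub_order1; first by rewrite !exprZn !fp.
    have -> : (p i *: lam) ^+ 2 * dir i - (p j *: lam) ^+ 2 * dir j =
        lam ^+ 2 * (p i ^+ 2 *: dir i - p j ^+ 2 *: dir j).
      by rewrite !exprZn -!scalerAl mulrBr -!scalerAr.
    have pi0 : p i ^+ 2 != 0.
      rewrite expf_neq0 //; apply: contraTneq (oner_neq0 K) => pi.
      by rewrite -(fp i) pi expr0n eqxx.
    apply: mulf_neq0; first by rewrite -(rmorph_nat (@mpolyC 4 K)) mpolyC_eq0.
    by apply: mulf_neq0; [exact: expf_neq0|apply: XX_neq => //; exact: dneq].
  by apply: (order_eqM (e := 2)); [apply: (order_eqM (e := 1))|]; apply: ord1.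
have ord0 i : i != l -> order_eq 0 (germ_var p l ^+ 3 - germ_var p i ^+ 3).
  move=> il; apply: cube_sub_order0.
  by rewrite pl fp // scale1r scale0r expr0n expf_neq0.
have ord3 i j : i != j -> i != l -> j != l ->
    order_eq 3 (germ_var p i ^+ 3 - germ_var p j ^+ 3).
  move=> ij il jl; rewrite /germ_var (fp i il) (fp j jl) !scale0r.
  apply: cube_sub_order3; have := oner_neq0 K; apply: contraNneq.
  move=> /(congr1 (meval (fun k => (k == lift ord_max i)%:R))).
  rewrite !rmorphXn /= !mevalXU eqxx eq_sym (negPf (dneq _ _ ij)).
  by rewrite expr1n expr0n => ->.
have ord0' i : i != l -> order_eq 0 (germ_var p i ^+ 3 - germ_var p l ^+ 3).
  by move=> il; apply: order_eqN; rewrite opprB; apply: ord0.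
move: ord0 ord0' ord3; elim/ord3_ind: l {pl fp} => ord0 ord0' ord3.
- apply: (order_eqM (e := 3)) (ord0' _ _) => //.
  by apply: (order_eqM (e := 0)); [exact: ord0|exact: ord3].
- apply: (order_eqM (e := 0)) (ord3 _ _ _ _ _) => //.
  by apply: (order_eqM (e := 0)); [exact: ord0'|exact: ord0].
- apply: (order_eqM (e := 3)) (ord0 _ _) => //.
  by apply: (order_eqM (e := 3)); [exact: ord3|exact: ord0'].
Qed.

End Multiplicity.

(** * Restriction to the nine lines *)

Section Lines.
Variable K : fieldType.
Hypothesis K3 : 3 != 0 :> K.

Local Notation A := {mpoly K[4]}.

Lemma ord3_shift_neq (l : 'I_3) :
  ((l + 1 == l)%R = false) * ((l == l + 1)%R = false) *
  ((l + 2 == l)%R = false) * ((l == l + 2)%R = false) *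
  ((l + 1 == l + 2)%R = false) * ((l + 2 == l + 1)%R = false).
Proof. by elim/ord3_ind: l. Qed.

Lemma ord3_shiftD (l : 'I_3) :
  (l + 1 + 1 = l + 2)%R * (l + 1 + 2 = l)%R * (l + 2 + 1 = l)%R *
  (l + 2 + 2 = l + 1)%R.
Proof. by elim/ord3_ind: l; do !split; apply: val_inj. Qed.

Definition on_line (B : Type) (l : 'I_3) (b b1 b2 : B) i : B :=
  if i == l then b else if i == l + 1 then b1 else b2.

(* The restriction of a polynomial to the line X_(l+1) = u X_(l+2), as a polynomial
   in X_(l+2) with coefficients in X_l. *)
Definition line_poly l (u : K) : {mpoly K[3]} -> {poly {mpoly K[3]}} :=
  mmap (polyC \o @mpolyC 3 K) (on_line l ('X_l)%:P (u%:MP%:P * 'X) 'X).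

HB.instance Definition _ l u := GRing.RMorphism.copy (line_poly l u)
  (mmap (polyC \o @mpolyC 3 K) (on_line l ('X_l)%:P (u%:MP%:P * 'X) 'X)).

(** Substituting polynomials of degree at most 1 does not raise the degree. *)
Lemma size_mmap n (B : comNzRingType) (h : K -> B) (v : 'I_n -> {poly B}) f :
  (forall i, (size (v i) <= 2)%N) ->
  (size (mmap (polyC \o h) v f) <= msize f)%N.
Proof.
move=> sv; rewrite /mmap big_seq_cond.
have pred_leq a b c d : (a <= c.+1 -> b <= d.+1 -> (a + b).-1 <= (c + d).+1)%N by lia.
elim/big_ind: _ => [|a b|m]; first by rewrite size_poly0.
  by move=> sa sb; apply: leq_trans (size_polyD _ _) _; rewrite geq_max sa.
rewrite andbT => /msize_mdeg_lt; apply: leq_trans.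
have s1 : (size (mmap1 v m) <= (mdeg m).+1)%N.
  rewrite /mmap1 mdegE.
  elim/big_rec2: _ => [|i d f' _ sf']; first by rewrite size_poly1.
  apply: leq_trans (size_polyMleq _ _) _.
  have si : (size (v i ^+ m i) <= (m i).+1)%N.
    apply: leq_trans (size_poly_exp_leq _ _) _; rewrite ltnS -{2}[m i]mul1n leq_mul2r.
    by rewrite -subn1 leq_subLR sv orbT.
  exact: pred_leq si sf'.
apply: leq_trans (size_polyMleq _ _) _; rewrite /= size_polyC.
by case: (_ != 0); [|apply: leq_trans s1; exact: leq_pred].
Qed.

Lemma size_line_poly l u f : (size (line_poly l u f) <= msize f)%N.
Proof.
apply: size_mmap => i; rewrite /on_line.
case: eqP => _; first by rewrite size_polyC; case: (_ != 0).
case: eqP => _; last by rewrite size_polyX.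
by rewrite mul_polyC (leq_trans (size_scale_leq _ _)) // size_polyX.
Qed.

(** The point (1, u c, c) lies on the line. Specializing the generic direction to (0, u, 1) and then
    shifting ['X] by c X_l turns the germ at this point into [line_poly]. *)
Lemma germ_line_poly l u c k f :
  vanishing_ideal (on_line l 1 (u * c) c) k f ->
  multiple_of (('X - (c *: 'X_l)%:P) ^+ k) (line_poly l u f).
Proof.
move=> [h eq_h].
pose spec (j : 'I_4) : {mpoly K[3]} :=
  if unlift ord_max j is Some i then on_line l 0 u%:MP 1 i else 'X_l.
pose phi : {rmorphism {poly A} -> {poly {mpoly K[3]}}} :=
  comp_poly ('X - (c *: 'X_l)%:P) \o map_poly (mmap (@mpolyC 3 K) spec).
exists (phi h).
have -> : ('X - (c *: 'X_l)%:P) ^+ k = phi ('X ^+ k).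
  by rewrite rmorphXn /= map_polyX comp_polyX.
rewrite -rmorphM -eq_h; apply/esym/rmorph_mmap => [a|i] /=.
  by rewrite map_polyC comp_polyC /= mmapC.
rewrite /germ_var rmorphD rmorphM /= map_polyX !map_polyC /= mmapZ !mmapXi.
rewrite /spec unlift_none liftK comp_polyD comp_polyM comp_polyX !comp_polyC.
rewrite /on_line; case: eqP => _; first by rewrite rmorph1 mul1r mulr0 addr0.
rewrite -mul_mpolyC; case: eqP => _; rewrite !(rmorphM, rmorph1) /=; ring.
Qed.

Definition line_subst l (u : K) i : {mpoly K[3]} :=
  if i == l + 1 then u *: 'X_(l + 2) else 'X_i.

Definition line_form l (u : K) : {mpoly K[3]} := 'X_(l + 1) - u *: 'X_(l + 2).

Lemma line_poly_eq0 l u f : line_poly l u f = 0 -> subst (line_subst l u) f = 0.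
Proof.
move=> /(congr1 (horner^~ 'X_(l + 2))); rewrite /= horner0 => <-.
rewrite -horner_evalE; apply/esym/rmorph_mmap => [c|i] /=.
  by rewrite horner_evalE hornerC.
rewrite horner_evalE /on_line /line_subst.
have [->|->|->] := ord3_cases l i; rewrite ?eqxx ?ord3_shift_neq.
- by rewrite hornerC.
- by rewrite hornerM hornerC hornerX mul_mpolyC.
- by rewrite hornerX.
Qed.

Lemma line_form_multiple l u f :
  subst (line_subst l u) f = 0 -> multiple_of (line_form l u) f.
Proof.
apply: subst_eq0_multiple => i; rewrite /line_subst /line_form.
case: eqP => [->|_]; first by exists 1; rewrite mulr1.
by exists 0; rewrite subrr mulr0.
Qed.

Lemma linear_form_neq0 i j (c : K) :
  i != j -> 'X_i - c *: 'X_j != 0 :> {mpoly K[3]}.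
Proof.
move=> ij; have := oner_neq0 K; apply: contraNneq.
move=> /(congr1 (meval (fun k => (k == i)%:R))).
rewrite mevalB mevalZ !mevalXU eqxx eq_sym (negPf ij).
by rewrite mulr0 subr0 meval0 => /eqP.
Qed.

(** For l' = l the restriction is a nonzero multiple of X_(l+2); otherwise some variable keeps the
    coefficient 1. *)
Lemma line_form_subst_neq0 l u l' u' : (l, u) != (l', u') ->
  subst (line_subst l u) (line_form l' u') != 0.
Proof.
rewrite /line_form -mul_mpolyC rmorphB rmorphM /= !substX /subst mmapC mul_mpolyC.
rewrite /line_subst.
have [->|->|->] := ord3_cases l l'.
- rewrite xpair_eqE eqxx /= => uu'; rewrite eqxx ord3_shift_neq -scalerBl.
  by rewrite -mul_mpolyC mulf_neq0 ?mpolyX_neq0 // mpolyC_eq0 subr_eq0.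
- move=> _; rewrite !ord3_shiftD !ord3_shift_neq.
  by apply: linear_form_neq0; rewrite ord3_shift_neq.
- move=> _; rewrite !ord3_shiftD eqxx ord3_shift_neq scalerA.
  by apply: linear_form_neq0; rewrite ord3_shift_neq.
Qed.

(** Lines are split off one at a time: the forms already split off stay nonzero on a further line,
    so the cofactor vanishes there. *)
Lemma prod_line_form_multiple (s : seq ('I_3 * K)) f : uniq s ->
  (forall e, e \in s -> subst (line_subst e.1 e.2) f = 0) ->
  multiple_of (\prod_(e <- s) line_form e.1 e.2) f.
Proof.
elim: s => [|e s IHs] /= => [_ _|/andP[es us] f0].
  by exists f; rewrite big_nil mul1r.
have [|h eq_f] := IHs us; first by move=> d ds; apply: f0; rewrite inE ds orbT.
have [|h' eq_h] := @line_form_multiple e.1 e.2 h.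
  have /eqP := f0 e (mem_head _ _); rewrite eq_f rmorphM mulf_eq0 => /orP[|/eqP//].
  rewrite rmorph_prod prodf_seq_eq0 => /hasP[d ds] /=; apply/contraTeq => _.
  apply: line_form_subst_neq0; rewrite -!surjective_pairing.
  by apply: contraNneq es => ->.
by exists h'; rewrite big_cons eq_f eq_h; ring.
Qed.

(** * The nine lines given by the cube roots of unity, and the degree bound *)

Variable w : K.
Hypothesis w_root : w ^+ 2 + w + 1 = 0.

Lemma w_cube : w ^+ 3 = 1.
Proof.
apply/eqP; rewrite -subr_eq0.
have -> : w ^+ 3 - 1 = (w - 1) * (w ^+ 2 + w + 1) by ring.
by rewrite w_root mulr0.
Qed.

(** These four values parametrize the four points on each line; w = 1 would give 3 = 0. *)
Lemma w_uniq : uniq [:: 0; 1; w; w ^+ 2].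
Proof.
have w1 : w != 1 by apply: contraNneq K3 => w1; rewrite -w_root w1; apply/eqP; ring.
have w0 : w != 0.
  by apply: contraTneq (oner_neq0 K) => w0; rewrite -w_cube w0 expr0n eqxx.
have w21 : w ^+ 2 != 1.
  by apply: contraNneq w1 => w2; rewrite -w_cube exprS w2 mulr1.
have ww2 : w != w ^+ 2.
  apply: contraNneq w1 => /(congr1 (fun t => t / w)).
  by rewrite expr2 mulfK // divff // => ->.
rewrite /= !inE !negb_or (eq_sym 0 1) (eq_sym 0 w) (eq_sym 0 (w ^+ 2)).
by rewrite (eq_sym 1 w) (eq_sym 1 (w ^+ 2)) oner_neq0 w0 w1 w21 ww2 expf_neq0.
Qed.

Lemma root_cube u : u \in [:: 1; w; w ^+ 2] -> u ^+ 3 = 1.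
Proof.
by rewrite !inE => /or3P[]/eqP->; rewrite ?expr1n // ?w_cube // exprAC w_cube expr1n.
Qed.

Lemma cube_sub_dec (B : comNzRingType) (a b v : B) : v ^+ 2 + v + 1 = 0 ->
  (a - b) * (a - v * b) * (a - v ^+ 2 * b) = a ^+ 3 - b ^+ 3.
Proof.
move=> v0; have -> : v ^+ 2 = - v - 1.
  by apply/eqP; rewrite -subr_eq0 -v0; apply/eqP; ring.
have v2 : v * v = - v - 1.
  by apply/eqP; rewrite -subr_eq0 -v0; apply/eqP; ring.
transitivity (a ^+ 3 - b ^+ 3 + (v * v + v + 1) * (b ^+ 3 - a * b ^+ 2)).
  by ring.
by rewrite v2; ring.
Qed.

(** As [msize] is the degree plus one, the restriction to each line has degree below 4 k, yet it has
    four roots of multiplicity k. *)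
Lemma vanishing_fermat_product_multiple k f :
  (forall l p, fermat_point l p -> vanishing_ideal p k f) ->
  (msize f <= 4 * k)%N -> multiple_of (fermat_product K) f.
Proof.
move=> Vf sf.
(* The indices 2, 0, 1 reproduce the order of the factors of [fermat_product]. *)
pose s := [seq (l, u) | l <- [:: 2; 0; 1] : seq 'I_3, u <- [:: 1; w; w ^+ 2]].
have -> : fermat_product K = \prod_(e <- s) line_form e.1 e.2 :> {mpoly K[3]}.
  have wC : w%:MP ^+ 2 + w%:MP + 1 = 0 :> {mpoly K[3]}.
    by rewrite -mpolyC1 -rmorphXn -!rmorphD w_root rmorph0.
  have E l : \prod_(u <- [:: 1; w; w ^+ 2]) line_form l u =
      'X_(l + 1) ^+ 3 - 'X_(l + 2) ^+ 3.
    rewrite !big_cons big_nil /line_form -!mul_mpolyC mpolyC1.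
    by rewrite mul1r mulr1 mulrA rmorphXn; apply: cube_sub_dec.
  rewrite big_allpairs (eq_bigr _ (fun l _ => E l)) !big_cons big_nil /=.
  rewrite mulr1 mulrA.
  have eqs : (2 + 1 = 0 :> 'I_3)%R * (2 + 2 = 1 :> 'I_3)%R *
      (0 + 1 = 1 :> 'I_3)%R * (0 + 2 = 2 :> 'I_3)%R * (1 + 2 = 0 :> 'I_3)%R.
    by do !split; apply: val_inj.
  by rewrite !eqs.
have uw : uniq [:: 1; w; w ^+ 2] by case/andP: w_uniq.
apply: prod_line_form_multiple.
  by apply: allpairs_uniq => // -[a b] [c d].
move=> _ /allpairsP[[l u] [_ /= wu ->]] /=; apply: line_poly_eq0.
(* The value 0 gives the coordinate point on the line, the cube roots of unity give the three points
   with all cubes 1. *)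
pose cs : seq {mpoly K[3]} := [seq c *: 'X_l | c <- [:: 0; 1; w; w ^+ 2]].
apply: (@prod_XsubC_multiple_eq0 _ k cs).
- rewrite map_inj_uniq; first exact: w_uniq.
  move=> c d /eqP; rewrite -subr_eq0 -scalerBl -mul_mpolyC mulf_eq0.
  by rewrite (negPf (mpolyX_neq0 _ _)) orbF mpolyC_eq0 subr_eq0 => /eqP.
- move=> _ /mapP[c cw ->]; apply/germ_line_poly/(Vf l).
  split; first by rewrite /on_line eqxx.
  move: cw; rewrite inE => /predU1P[->|/root_cube cw]; [right|left] => i.
    by rewrite /on_line => /negPf->; rewrite mulr0 if_same.
  rewrite /on_line; case: ifP; rewrite ?expr1n //.
  by case: ifP; rewrite // exprMn cw root_cube // mulr1.
- by rewrite size_map (leq_trans (size_line_poly _ _ _)) // mulnC.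
Qed.

Lemma cube_sub_homog i j : 'X_i ^+ 3 - 'X_j ^+ 3 \is [in K[3], 3.-homog].
Proof.
by apply: rpredB; apply: (dhomogMn (d := 1)); rewrite dhomogX /= mdeg1.
Qed.

Lemma cube_sub_neq0 i j : i != j -> 'X_i ^+ 3 - 'X_j ^+ 3 != 0 :> {mpoly K[3]}.
Proof.
move=> ij; have := oner_neq0 K; apply: contraNneq.
move=> /(congr1 (meval (fun k => (k == i)%:R))).
rewrite mevalB !rmorphXn /= !mevalXU eqxx eq_sym (negPf ij) meval0.
by rewrite expr1n expr0n subr0 => ->.
Qed.

Lemma fermat_product_homog : fermat_product K \is 9.-homog.
Proof.
have X3 := cube_sub_homog.
by apply: (dhomogM (d := 6)) => //; apply: (dhomogM (d := 3)).
Qed.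

Lemma fermat_product_neq0 : fermat_product K != 0.
Proof. by rewrite !mulf_neq0 ?cube_sub_neq0. Qed.

Lemma dhomog_msizeE n (f : {mpoly K[n]}) d :
  f != 0 -> f \is d.-homog -> msize f = d.+1.
Proof.
by move=> f0 /dhomogP hf; rewrite -mlead_deg // -(hf _ (mlead_supp f0)).
Qed.

(** D splits off because 9 m + 4 <= 4 (3 m + 1). For m = 0 this contradicts deg D = 9; otherwise the
    quotient loses 3 in order at each point and 9 in degree. *)
Lemma vanishing_msize m (f : {mpoly K[3]}) : f != 0 ->
  (forall l p, fermat_point l p -> vanishing_ideal p (3 * m + 1) f) ->
  (9 * m + 5 <= msize f)%N.
Proof.
elim: m f => [|m IHm] f f0 Vf; rewrite leqNgt; apply/negP => sf;
  (have [|h eq_f] := vanishing_fermat_product_multiple Vf; first by move: sf; lia);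
  have h0 : h != 0 by [apply: contraNneq f0 => h0; rewrite eq_f h0 mulr0].
  move: sf; rewrite eq_f msizeM ?fermat_product_neq0 //.
  by rewrite (dhomog_msizeE fermat_product_neq0 fermat_product_homog); lia.
have /(IHm h h0) : forall l p, fermat_point l p -> vanishing_ideal p (3 * m + 1) h.
  move=> l p fp; have := Vf l p fp; rewrite eq_f /vanishing_ideal /= rmorphM /=.
  rewrite (_ : 3 * m.+1 + 1 = 3 * m + 1 + 3)%N; last by lia.
  exact: (order_eq_multiple (germ_fermat_product K3 fp)).
have arith a : ((10 + a).-1 < 9 * m.+1 + 5 -> 9 * m + 5 <= a -> False)%N by lia.
move: sf; rewrite eq_f msizeM ?fermat_product_neq0 //.
by rewrite (dhomog_msizeE fermat_product_neq0 fermat_product_homog); apply: arith.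
Qed.

End Lines.

(** * The initial degree *)

Section UpperBound.
Variable K : fieldType.

Local Notation I := (@fermat_ideal K).

(** If the annihilator P of g contained all variables, saturation would put g in I and hence 1 in
    P. *)
Lemma assoc_prime_avoids P : assoc_primes I P -> exists i, ~ P 'X_i.
Proof.
move=> [[[_ P1 _] _] [g eq_P]]; apply: contrapT => PX.
have /negP[] := P1; apply/mem_set; rewrite eq_P /= mul1r.
apply: fermat_saturated => i.
have : P 'X_i by apply: contrapT => Xi; apply: PX; exists i.
by rewrite eq_P.
Qed.

Lemma prime_idealX (A : idomainType) (P : set A) (a : A) n :
  prime_ideal P -> ~ P a -> ~ P (a ^+ n).
Proof.
move=> [[_ P1 _] PM] Pa; elim: n => [|n IHn].
  by rewrite expr0 => /mem_set P1'; case/negP: P1.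
by rewrite exprS => /mem_set/PM/orP[/set_mem|/set_mem].
Qed.

Lemma fermat_product_cubeX i : ideal_pow I 3 ('X_i ^+ 9 * fermat_product K).
Proof.
have g0 := @fermat_gen0 K; have g1 := @fermat_gen1 K; have g2 := @fermat_gen2 K.
have idI := @fermat_ideal_ideal K; rewrite /fermat_product.
elim/ord3_ind: i; first exact: fermat_product_cube.
  (* D is invariant under cyclic rotation of the variables. *)
  by rewrite -[X in _ * X]mulrA [X in _ * X]mulrC; apply: fermat_product_cube.
by rewrite [X in _ * X]mulrC [X in _ * X]mulrA; apply: fermat_product_cube.
Qed.

(** Some ['X_i] is a unit in the localization, and X_i^(9m) D^m is the m-th power of an element of
    I^3; the remaining generator supplies the last factor from I. *)
Lemma fermat_product_symbolic m :
  symbolic_power I (3 * m + 1)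
    (fermat_product K ^+ m * ('X_0 * ('X_1 ^+ 3 - 'X_2 ^+ 3))).
Proof.
move=> P assP /=; have [i Xi] := assoc_prime_avoids assP.
have PX := @prime_idealX _ P _ (9 * m) assP.1 Xi.
have X0 : ('X_i ^+ (9 * m) : {mpoly K[3]}) != 0 by rewrite expf_neq0 ?mpolyX_neq0.
set a := 'X_0 * _.
exists 1%N, (fun=> 1%:F / ('X_i ^+ (9 * m))%:F).
exists (fun=> ('X_i ^+ 9 * fermat_product K) ^+ m * a); split=> [_|_|].
- by exists 1, ('X_i ^+ (9 * m)).
- apply: ideal_powM; first exact/ideal_powX/fermat_product_cubeX.
  exact/ideal_pow1/fermat_gen0.
- have -> : ('X_i ^+ 9 * fermat_product K) ^+ m * a =
      'X_i ^+ (9 * m) * (fermat_product K ^+ m * a).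
    by rewrite [(_ * _) ^+ m]exprMn exprM mulrA.
  by rewrite big_ord1 tofrac1 mul1r [in RHS]tofracM mulKf // tofrac_eq0.
Qed.

End UpperBound.

Lemma alpha_eq (K : fieldType) n (J : set {mpoly K[n]}) d :
  has_form_of_degree J d -> (forall e, has_form_of_degree J e -> (d <= e)%N) ->
  alpha J = d.
Proof.
move=> Jd min_d; apply: xget_unique => // e [Je min_e].
by apply/eqP; rewrite eqn_leq min_e ?min_d.
Qed.

Lemma alpha_fermat_symbolic (K : fieldType) (w : K) (m : nat) :
  3 != 0 :> K -> w ^+ 2 + w + 1 = 0 ->
  alpha (symbolic_power (@fermat_ideal K) (3 * m + 1)) = (9 * m + 4)%N.
Proof.
move=> K3 w_root; apply: alpha_eq => [|e [f [If f0 homf]]].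
  exists (fermat_product K ^+ m * ('X_0 * ('X_1 ^+ 3 - 'X_2 ^+ 3))); split.
  - exact: fermat_product_symbolic.
  - rewrite mulf_neq0 ?expf_neq0 ?fermat_product_neq0 //.
    by rewrite mulf_neq0 ?mpolyX_neq0 ?cube_sub_neq0.
  - apply: dhomogM; first exact/dhomogMn/fermat_product_homog.
    apply: (dhomogM (d := 1) (e := 3)) (cube_sub_homog _ _ _).
    by rewrite dhomogX /= mdeg1.
have := vanishing_msize K3 w_root f0 (fun l p fp => symbolic_power_germ K3 fp If).
by rewrite (dhomog_msizeE f0 homf) addnS.
Qed.

Theorem theorem3p5 (R : realType) (m : nat) :
  alpha (symbolic_power (I3 R) (3 * m + 1)) = (9 * m + 4)%N.
Proof.
have C3 : 3 != 0 :> R[i] by rewrite Num.Theory.pnatr_eq0.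
have [w w_root] : exists w : R[i], w ^+ 2 + w + 1 = 0.
  (* Algebraic closedness solves w^2 = -1 - w. *)
  have [w ew] := @solve_monicpoly R[i] 2 (fun=> -1) isT.
  exists w; rewrite ew !big_ord_recl big_ord0 /=; ring.
exact: alpha_fermat_symbolic C3 w_root.
Qed.
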